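(* Let $\tau>0$, $a>0$, let $s,d$ be integers with $1\le s\le d$ and let $\ell\in\mathcal L$. Then $$\inf_{\hat T}\sup_{P_\xi\in\mathcal G_{a,\tau}}\sup_{\sigma>0}\sup_{\theta\in\Theta_s}\mathbf E_{\theta,P_\xi,\sigma}\,\ell\Big(c\,\phi_{\rm exp}(s,d)^{-1}\Big|\frac{\hat T}{\sigma^2}-1\Big|\Big)\ge c',$$ where $\phi_{\rm exp}(s,d)=\max\big(\frac1{\sqrt d},\frac sd\log^{2/a}(\frac{ed}{s})\big)$ and $c,c'>0$ depend only on $\ell$, $a$ and $\tau$.
   Context: Model: $Y_i=\theta_i+\sigma\xi_i$, $i=1,\dots,d$, $\theta\in\mathbb R^d$, $\sigma>0$, $\xi_i$ i.i.d. with distribution $P_\xi$; $\mathbf E_{\theta,P_\xi,\sigma}$ expectation; $\Theta_s=\{\theta:\|\theta\|_0\le s\}$. $\mathcal G_{a,\tau}$: distributions with $\mathbf E\xi_1=0,\mathbf E\xi_1^2=1$, $\mathbf P(|\xi_1|>t)\le2e^{-(t/\tau)^a}$ for all $t\ge2$. $\mathcal L$: nondecreasing $\ell:[0,\infty)\to[0,\infty)$, $\ell(0)=0$, $\ell\not\equiv0$; $\inf_{\hat T}$ over all estimators. *)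

(* Defs.v *)
From HB Require Import structures.
From mathcomp Require Import all_boot all_order all_algebra.
From mathcomp Require Import all_classical all_reals all_analysis.
Set Implicit Arguments. Unset Strict Implicit. Unset Printing Implicit Defensive.
Import Order.TTheory GRing.Theory Num.Theory.
Import numFieldNormedType.Exports.
Local Open Scope classical_set_scope.
Local Open Scope ring_scope.

Section defs.
Variable R : realType.

(* Expectation of g(xi_1,...,xi_n) for xi_1,...,xi_n i.i.d. with law P,
   written as the iterated integral w.r.t. the n-fold product of P
   (equal to the product-measure integral by Tonelli for nonnegative
   measurable g). *)
Fixpoint iid_expect (P : probability R R) (n : nat) :
    (n.-tuple R -> \bar R) -> \bar R :=
  match n with
  | 0 => fun g => g [tuple]
  | n'.+1 => fun g =>
      (\int[P]_x iid_expect P (fun t : n'.-tuple R => g [tuple of x :: t]))%E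
  end.

Definition obs (d : nat) (theta : d.-tuple R) (sigma : R) (xi : d.-tuple R)
  : d.-tuple R := [tuple tnth theta i + sigma * tnth xi i | i < d].

Definition model_expect (d : nat) (P : probability R R) (sigma : R)
  (theta : d.-tuple R) (g : d.-tuple R -> \bar R) : \bar R :=
  iid_expect P (fun xi => g (obs theta sigma xi)).

Definition G_class (a tau : R) (P : probability R R) : Prop :=
  [/\ P.-integrable setT (fun x : R => x%:E),
      (\int[P]_x x%:E = 0)%E,
      (\int[P]_x (x ^+ 2)%:E = 1)%E &
      forall t : R, 2 <= t ->
        (P [set x : R | (t < `|x|)%R] <= (2 * expR (- ((t / tau) `^ a)))%:E)%E].

Definition sparse (d s : nat) (theta : d.-tuple R) : Prop :=
  (#|[set i : 'I_d | tnth theta i != 0%R]| <= s)%N.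

(* The loss class L (losses defined on [0, +oo); values off [0,+oo) irrelevant) *)
Definition loss_class (l : R -> R) : Prop :=
  [/\ {in `[0, +oo[ &, {homo l : x y / x <= y}},
      l 0 = 0,
      (forall x, 0 <= x -> 0 <= l x) &
      exists x, 0 <= x /\ l x != 0].

Definition phi_exp (a : R) (s d : nat) : R :=
  Num.max (Num.sqrt (d%:R))^-1
          (s%:R / d%:R * (ln (expR 1 * d%:R / s%:R)) `^ (2 / a)).

End defs.

(* Main.v *)
Require Import Defs.
From HB Require Import structures.
From mathcomp Require Import all_boot all_order all_algebra.
From mathcomp Require Import all_classical all_reals all_analysis.
From mathcomp Require Import measurable_realfun ring lra.
Import Order.TTheory GRing.Theory Num.Theory.
Import numFieldNormedType.Exports.
Local Open Scope classical_set_scope.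
Local Open Scope ring_scope.

(** Both terms of the rate come from pairs of hypotheses with finitely supported
    noise.

    Parametric term: take theta = 0 and let each Y_i be 0 with probability
    1 - q and a fair sign otherwise, so that sigma^2 = q.  The choices q = 1/2
    and q = 1/2 + 1/(4 sqrt d) have relative variance gap of order 1/sqrt d,
    while the chi-square divergence of the d-fold products stays bounded.

    Sparse term: let Y_i = B k_i + e_i with e_i a fair sign and k_i in {-1,0,1}
    nonzero with probability p = s/(2d).  This can be read as theta = B k with
    noise e and sigma^2 = 1, or as theta = 0 with an outlier-contaminated noise
    and sigma^2 = 1 + p B^2.  The law of Y is the same, so no estimator is good
    in both readings; by Markov's inequality B k is s-sparse with probability at
    least 1/2.  The tail condition defining the noise class allows B of order
    log^(1/a)(ed/s). *)

(** * Finitely supported laws on the real line *)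

Section discrete_law.
Context {R : realType} {I : finType} (w x : I -> R).
Hypotheses (w_ge0 : forall i, 0 <= w i) (w_sum1 : \sum_i w i = 1).

Let atom (i : I) : {measure set R -> \bar R} :=
  mscale (NngNum (w_ge0 i)) (dirac (x i)).

(** [msum] expects measures indexed by [nat], so the atoms are enumerated and padded with the zero
    measure from [#|I|] on. *)
Let atom_seq (k : nat) : {measure set R -> \bar R} :=
  oapp (fun j : 'I_#|I| => atom (enum_val j)) mzero (insub k).

Let atom_sum (F : {measure set R -> \bar R} -> \bar R) :
  (\sum_(k < #|I|) F (atom_seq k) = \sum_i F (atom i))%E.
Proof.
rewrite [RHS](@big_enum_val _ _ _ _ predT (fun i => F (atom i)))/=.
by apply: eq_bigr => k _; rewrite /atom_seq valK.
Qed.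

Definition discrete_law_fun : set R -> \bar R := msum atom_seq #|I|.

HB.instance Definition _ := Measure.on discrete_law_fun.

Lemma discrete_lawE (A : set R) :
  discrete_law_fun A = (\sum_i w i * (x i \in A)%:R)%:E.
Proof.
rewrite /discrete_law_fun /msum (atom_sum (fun m => m A)) -sumEFin.
by apply: eq_bigr => i _; rewrite /= /mscale/= diracE -EFinM.
Qed.

Let discrete_law_setT : discrete_law_fun setT = 1%E.
Proof.
rewrite discrete_lawE; congr EFin; rewrite -[RHS]w_sum1.
by apply: eq_bigr => i _; rewrite mem_set// mulr1.
Qed.

HB.instance Definition _ :=
  Measure_isProbability.Build _ _ _ discrete_law_fun discrete_law_setT.

Definition discrete_law : probability R R := discrete_law_fun.

Lemma ge0_integral_discrete_law (f : R -> R) :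
  (forall t, 0 <= f t) -> measurable_fun setT f ->
  (\int[discrete_law]_t (f t)%:E = (\sum_i w i * f (x i))%:E)%E.
Proof.
move=> f0 mf; have /measurable_EFinP mf' := mf.
rewrite /discrete_law/= /discrete_law_fun ge0_integral_measure_sum//.
rewrite (atom_sum (fun m => \int[m]_t (f t)%:E)%E) -sumEFin.
apply: eq_bigr => i _; rewrite ge0_integral_mscale//.
- by rewrite integral_dirac// diracT mul1e.
- by move=> t _; rewrite lee_fin.
- by move=> t _; rewrite lee_fin.
Qed.

Lemma integral_discrete_law (f : R -> R) : measurable_fun setT f ->
  (\int[discrete_law]_t (f t)%:E = (\sum_i w i * f (x i))%:E)%E.
Proof.
move=> mf; rewrite integralE.
have -> : ((fun t => (f t)%:E) ^\+ = fun t => (Num.max (f t) 0)%:E)%E.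
  by apply/funext => t; rewrite funeposE EFin_max.
have -> : ((fun t => (f t)%:E) ^\- = fun t => (Num.max (- f t) 0)%:E)%E.
  by apply/funext => t; rewrite funenegE EFin_max.
rewrite !ge0_integral_discrete_law; last first.
- by apply: measurable_maxr.
- by move=> t; rewrite le_max lexx orbT.
- by apply: measurable_maxr => //; exact: measurableT_comp.
- by move=> t; rewrite le_max lexx orbT.
rewrite -EFinB -sumrB; congr EFin; apply: eq_bigr => i _.
by rewrite -mulrBr; congr (_ * _); case: (leP (f (x i)) 0); case: (leP (- f (x i)) 0); lra.
Qed.

Lemma integrable_discrete_law (f : R -> R) : measurable_fun setT f ->
  discrete_law.-integrable setT (EFin \o f).
Proof.
move=> mf; apply/integrableP; split; first exact/measurable_EFinP.
under eq_integral do rewrite /=.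
rewrite ge0_integral_discrete_law ?ltry//.
exact: measurableT_comp.
Qed.

(* [f] need not be measurable: the integral is a supremum over simple functions
   below [f], one of which is [F] restricted to the atoms. *)
Lemma discrete_law_le_integral (F : R -> R) (f : R -> \bar R) :
  (forall t, 0 <= F t) -> (forall t, ((F t)%:E <= f t)%E) ->
  ((\sum_i w i * F (x i))%:E <= \int[discrete_law]_t f t)%E.
Proof.
move=> F0 Ff.
(* [x] may take a value several times; without [undup], [g] would count [F] there more than once. *)
pose u := undup [seq x i | i : I].
pose g t := \sum_(z <- u) F z * \1_[set z] t.
have gE t : g t = if t \in u then F t else 0.
  rewrite /g; case: ifPn => tu.
    rewrite (bigD1_seq t) ?undup_uniq//= indicE mem_set// mulr1 big1 ?addr0//.
    by move=> z zt; rewrite indicE memNset ?mulr0// => /= tz; rewrite tz eqxx in zt.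
  rewrite big1_seq// => z /= zu; rewrite indicE memNset ?mulr0// => /= tz.
  by rewrite tz zu in tu.
have g0 t : 0 <= g t by rewrite gE; case: ifP.
have mg : measurable_fun setT g.
  by apply: measurable_sum => z; apply: measurable_funM.
have -> : \sum_i w i * F (x i) = \sum_i w i * g (x i).
  by apply: eq_bigr => i _; rewrite gE mem_undup fintype.image_f.
rewrite -ge0_integral_discrete_law// !ge0_integralTE//; last first.
  by move=> t; apply: le_trans (Ff t); rewrite lee_fin.
apply: le_ereal_sup => _ [h /= hg <-]; exists h => //= t.
apply: (le_trans (hg t)); apply: le_trans (Ff t).
by rewrite lee_fin gE; case: ifP.
Qed.

Lemma discrete_law_G_class (a tau : R) :
  \sum_i w i * x i = 0 -> \sum_i w i * x i ^+ 2 = 1 ->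
  (forall t, 2 <= t -> \sum_i w i * (t < `|x i|)%R%:R
                       <= 2 * expR (- ((t / tau) `^ a))) ->
  G_class a tau discrete_law.
Proof.
move=> x_mean x_var x_tail; split.
- exact: (integrable_discrete_law id).
- by rewrite (integral_discrete_law id)// x_mean.
- by rewrite integral_discrete_law ?x_var//; exact: exprn_measurable.
- move=> t t2; rewrite /discrete_law/= discrete_lawE lee_fin.
  apply: le_trans (x_tail t t2); rewrite le_eqVlt; apply/orP; left; apply/eqP.
  apply: eq_bigr => i _; congr (_ * (nat_of_bool _)%:R); by apply/idP/idP; rewrite inE.
Qed.

End discrete_law.

Arguments discrete_law {R I w} x w_ge0 w_sum1.

(** * Sums over tuples and i.i.d. expectations *)

Lemma tuple_sum_cons {V : nmodType} {I : finType} (n : nat) (F : n.+1.-tuple I -> V) :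
  \sum_(f : n.+1.-tuple I) F f = \sum_i \sum_(f : n.-tuple I) F [tuple of i :: f].
Proof.
rewrite pair_bigA/= (reindex (fun u : I * n.-tuple I => [tuple of u.1 :: u.2])).
  by [].
exists (fun f => (thead f, [tuple of behead f])) => [[i f] _|f _] /=.
  by congr (_, _); apply/val_inj.
by rewrite -tuple_eta.
Qed.

Section discrete_iid.
Context {R : realType} {I : finType} (w x : I -> R).
Hypotheses (w_ge0 : forall i, 0 <= w i) (w_sum1 : \sum_i w i = 1).
Let P : probability R R := discrete_law x w_ge0 w_sum1.

(** Induction on [n]. The inner expectation, as a function of the first coordinate, need not be
    measurable, so each integral is only bounded below through a real minorant. *)
Lemma iid_expect_discrete_ge (n : nat) (G : n.-tuple R -> R) (g : n.-tuple R -> \bar R) :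
  (forall t, 0 <= G t) -> (forall t, ((G t)%:E <= g t)%E) ->
  ((\sum_(f : n.-tuple I) (\prod_(i < n) w (tnth f i)) * G (map_tuple x f))%:E
    <= iid_expect P g)%E.
Proof.
elim: n G g => [|n IHn] G g G0 Gg.
  rewrite /= (eq_bigr (fun=> G [tuple])); last first.
    by move=> f _; rewrite big_ord0 mul1r; congr G; apply/val_inj; rewrite (tuple0 f).
  by rewrite sumr_const card_tuple expn0 mulr1n.
rewrite /= tuple_sum_cons.
pose F t := \sum_(f : n.-tuple I) (\prod_(i < n) w (tnth f i)) *
  G [tuple of t :: map_tuple x f].
rewrite [leLHS](_ : _ = (\sum_i w i * F (x i))%:E); last first.
  congr EFin; apply: eq_bigr => i _; rewrite /F mulr_sumr; apply: eq_bigr => f _.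
  rewrite big_ord_recl tnth0 mulrA; congr (_ * _ * G _); last exact/val_inj.
  by apply: eq_bigr => j _; rewrite tnthS.
apply: (discrete_law_le_integral w x w_ge0 w_sum1) => t.
  by apply: sumr_ge0 => f _; rewrite mulr_ge0//; apply: prodr_ge0.
by apply: (IHn (fun s => G [tuple of t :: s])) => s; [exact: G0 | exact: Gg].
Qed.

End discrete_iid.

(** * Testing and counting under product weights *)

Section product_weights.
Context {R : realFieldType} {I : finType}.

Lemma sum_prod_tuple (n : nat) (F : 'I_n -> I -> R) :
  \sum_(f : n.-tuple I) \prod_(i < n) F i (tnth f i) = \prod_(i < n) \sum_j F i j.
Proof.
elim: n F => [|n IHn] F.
  rewrite big_ord0 (eq_bigr (fun=> 1)) => [|f _]; last by rewrite big_ord0.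
  by rewrite sumr_const card_tuple expn0.
rewrite tuple_sum_cons big_ord_recl -IHn mulr_suml; apply: eq_bigr => j _.
rewrite mulr_sumr; apply: eq_bigr => f _.
by rewrite big_ord_recl tnth0; congr (_ * _); apply: eq_bigr => i _; rewrite tnthS.
Qed.

Lemma sum_prod_tuple1 (n : nat) (w : I -> R) : \sum_j w j = 1 ->
  \sum_(f : n.-tuple I) \prod_(i < n) w (tnth f i) = 1.
Proof.
by move=> w1; rewrite (sum_prod_tuple n (fun=> w)) w1 prodr_const expr1n.
Qed.

(* Pointwise, min (W0, W1) >= W1 - W1^2 / (4 W0), since (W0 - W1/2)^2 >= 0. *)
Lemma two_point_test (n : nat) (w0 w1 : I -> R) (b0 b1 : n.-tuple I -> bool) :
  (forall j, 0 < w0 j) -> (forall j, 0 <= w1 j) -> \sum_j w1 j = 1 ->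
  (forall f, b0 f || b1 f) ->
  1 - (\sum_j w1 j ^+ 2 / w0 j) ^+ n / 4 <=
    \sum_f (\prod_(i < n) w0 (tnth f i)) * (b0 f)%:R +
    \sum_f (\prod_(i < n) w1 (tnth f i)) * (b1 f)%:R.
Proof.
move=> w0_gt0 w1_ge0 w1_sum b01.
(* One plus the chi-square divergence is multiplicative over independent coordinates. *)
have -> : (\sum_j w1 j ^+ 2 / w0 j) ^+ n =
    \sum_(f : n.-tuple I) (\prod_(i < n) w1 (tnth f i)) ^+ 2 /
                          \prod_(i < n) w0 (tnth f i).
  rewrite -[in LHS](card_ord n) -prodr_const -sum_prod_tuple.
  by apply: eq_bigr => f _; rewrite prodf_div prodrXl.
rewrite -[X in X - _](sum_prod_tuple1 n w1 w1_sum) mulr_suml -sumrB -big_split/=.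
apply: ler_sum => f _.
set W0 := \prod_(i < n) w0 _; set W1 := \prod_(i < n) w1 _.
have W0_gt0 : 0 < W0 by apply: prodr_gt0.
have W1_ge0 : 0 <= W1 by apply: prodr_ge0.
have W01 : W1 - W1 ^+ 2 / W0 / 4 <= W0.
  have -> : W1 - W1 ^+ 2 / W0 / 4 = W0 - (W0 - W1 / 2) ^+ 2 / W0.
    by field; rewrite gt_eqF.
  by rewrite gerBl divr_ge0 ?sqr_ge0// ltW.
have W11 : W1 - W1 ^+ 2 / W0 / 4 <= W1.
  by rewrite gerBl !divr_ge0 ?sqr_ge0// ltW.
move: (b01 f); case: (b0 f); case: (b1 f) => //= _; rewrite ?mulr1 ?mulr0; lra.
Qed.

(** Markov's inequality for the number of coordinates satisfying [q], whose mean is [n] times the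
    weight of [q]. *)
Lemma count_tail (n s : nat) (w : I -> R) (q : pred I) :
  (forall j, 0 <= w j) -> \sum_j w j = 1 -> (0 < s)%N ->
  1 - n%:R * (\sum_(j | q j) w j) / s%:R <=
  \sum_(f : n.-tuple I | (\sum_(i < n) q (tnth f i) <= s)%N)
     \prod_(i < n) w (tnth f i).
Proof.
move=> w_ge0 w_sum s_gt0.
have s_gt0R : 0 < s%:R :> R by rewrite ltr0n.
have expected_count : \sum_(f : n.-tuple I) (\prod_(i < n) w (tnth f i)) *
    (\sum_(i < n) q (tnth f i))%N%:R = n%:R * \sum_(j | q j) w j.
  under eq_bigr do rewrite natr_sum mulr_sumr.
  rewrite exchange_big/= -[in RHS](card_ord n) -sum1_card natr_sum mulr_suml.
  apply: eq_bigr => i _; rewrite mul1r.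
  (* Putting the indicator of [q] into factor [i] alone keeps each summand a product over
     coordinates. *)
  pose F (k : 'I_n) (j : I) : R := w j * (if k == i then (q j)%:R else 1).
  rewrite (eq_bigr (fun f : n.-tuple I => \prod_(k < n) F k (tnth f k))).
    rewrite sum_prod_tuple (bigD1 i)//= [X in _ * X]big1 ?mulr1.
      rewrite [RHS]big_mkcond; apply: eq_bigr => j _.
      by rewrite /F eqxx; case: (q j); rewrite ?mulr1 ?mulr0.
    move=> k /negPf ki; rewrite /F ki -[RHS]w_sum.
    by apply: eq_bigr => j _; rewrite mulr1.
  move=> f _; rewrite big_split/=; congr (_ * _).
  rewrite (bigD1 i)//= eqxx big1 ?mulr1// => k /negPf ->//.
(* Termwise this is [1 <= [count <= s] + count / s]. *)
rewrite -expected_count lerBlDr -[leLHS](sum_prod_tuple1 n w w_sum) mulr_suml.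
rewrite [X in _ <= X + _]big_mkcond -big_split/=; apply: ler_sum => f _.
have W_ge0 : 0 <= \prod_(i < n) w (tnth f i) by apply: prodr_ge0.
case: ifPn => [_|].
  by rewrite lerDl divr_ge0 ?mulr_ge0// ltW.
rewrite -ltnNge => /ltnW sN; rewrite add0r -mulrA ler_peMr//.
by rewrite ler_pdivlMr// mul1r ler_nat.
Qed.

End product_weights.

(** * Reindexed sums and the separation of two variances *)

Lemma tuple_sum_pair {V : nmodType} {I J : finType} (n : nat)
    (F : n.-tuple (I * J) -> V) :
  \sum_f F f =
  \sum_(k : n.-tuple I) \sum_(e : n.-tuple J) F [tuple (tnth k i, tnth e i) | i < n].
Proof.
rewrite pair_bigA/=.
rewrite (reindex (fun u : n.-tuple I * n.-tuple J =>
  [tuple (tnth u.1 i, tnth u.2 i) | i < n]))//=.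
exists (fun f => (map_tuple fst f, map_tuple snd f)) => [[k e] _|f _] /=.
  by congr (_, _); apply: eq_from_tnth => i; rewrite tnth_map tnth_mktuple.
by apply: eq_from_tnth => i; rewrite tnth_mktuple !tnth_map -surjective_pairing.
Qed.

Lemma sum_option_bool {V : nmodType} (F : option bool -> V) :
  \sum_o F o = F None + (F (Some true) + F (Some false)).
Proof.
rewrite (bigD1 None)//= (bigD1 (Some true))//= (bigD1 (Some false))//=.
by rewrite big_pred0 ?addr0// => -[[]|].
Qed.

(** If both relative errors were below [delta], then [(1 - delta) * v < t < (1 + delta) * u], which
    forces [v - u < delta * (v + u)]. *)
Lemma variance_separation {R : realFieldType} (t u v delta : R) :
  0 < u -> 0 < v -> delta <= (v - u) / (v + u) ->
  (delta <= `|t / u - 1|) || (delta <= `|t / v - 1|).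
Proof.
move=> u0 v0 hd; rewrite -[_ || _]negbK negb_or -!ltNge; apply/negP => /andP[].
rewrite !ltr_norml => /andP[_ hu] /andP[hv _].
move: hd; rewrite ler_pdivlMr ?addr_gt0// => hd.
have {}hu : t < (1 + delta) * u by rewrite -ltr_pdivrMr//; lra.
have {}hv : (1 - delta) * v < t by rewrite -ltr_pdivlMr//; lra.
nra.
Qed.

(** * Noise laws of the two constructions *)

Definition three_weight {R : realFieldType} (q : R) (o : option bool) : R :=
  if o is Some _ then q / 2 else 1 - q.

Definition sign_of {R : realFieldType} (b : bool) : R := if b then 1 else -1.

(** Under [three_weight q], the parameter [q] is both the probability of a nonzero value and the
    variance. *)
Definition three_value {R : realFieldType} (o : option bool) : R :=
  if o is Some b then sign_of b else 0.

Lemma sum_three_weight {R : realFieldType} (q : R) : \sum_o three_weight q o = 1.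
Proof. by rewrite sum_option_bool /=; field. Qed.

Lemma three_weight_gt0 {R : realFieldType} (q : R) (o : option bool) :
  0 < q < 1 -> 0 < three_weight q o.
Proof. by case: o => [b|] /= /andP[q0 q1]; rewrite ?subr_gt0// divr_gt0. Qed.

(** After normalization the values have modulus at most [1 / sqrt q <= 2], so the tails beyond
    [t >= 2] vanish whatever [a] and [tau] are. *)
Lemma three_law_G_class {R : realType} (a tau q : R) (q0 : 2^-1 <= q)
    (wq : forall o, 0 <= three_weight q o) :
  G_class a tau (discrete_law (fun o => three_value o / Num.sqrt q) wq
                              (sum_three_weight q)).
Proof.
have q_gt0 : 0 < q by lra.
have sq_gt0 : 0 < Num.sqrt q by rewrite sqrtr_gt0.
have sq2 : Num.sqrt q ^+ 2 = q by rewrite sqr_sqrtr ?ltW.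
apply: discrete_law_G_class.
- by rewrite sum_option_bool /=; field; rewrite gt_eqF.
- rewrite sum_option_bool /= !exprMn !exprVn sq2; field; rewrite gt_eqF//.
- move=> t t2; rewrite big1 ?mulr_ge0 ?expR_ge0// => o _.
  have sq_ge : 2^-1 <= Num.sqrt q by rewrite -ler_sqr ?nnegrE ?sq2; nra.
  suff /negbTE-> : ~~ (t < `|three_value o / Num.sqrt q|) by rewrite mulr0.
  rewrite -leNgt; apply: le_trans t2.
  rewrite normrM normfV (gtr0_norm sq_gt0) ler_pdivrMr//.
  by case: o => [[]|] /=; rewrite ?normrN ?normr1 ?normr0; lra.
Qed.

Lemma fair_coin_ge0 {R : realFieldType} (e : bool) : 0 <= 2^-1 :> R.
Proof. by []. Qed.

Lemma sum_fair_coin {R : realFieldType} : \sum_(e : bool) 2^-1 = 1 :> R.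
Proof. by rewrite big_bool /=; field. Qed.

Lemma rademacher_G_class {R : realType} (a tau : R) :
  G_class a tau (discrete_law sign_of fair_coin_ge0 sum_fair_coin).
Proof.
apply: discrete_law_G_class; rewrite ?big_bool/=; [by field|by field|].
move=> t t2; rewrite big1 ?mulr_ge0 ?expR_ge0// => e _.
suff /negbTE-> : ~~ (t < `|sign_of e|) by rewrite mulr0.
by rewrite -leNgt (le_trans _ t2)//; case: e; rewrite /= ?normrN normr1 ler1n.
Qed.

Lemma sparseE {R : realType} (d s : nat) (theta : d.-tuple R) :
  sparse s theta = (\sum_(i < d) (tnth theta i != 0%R) <= s)%N.
Proof.
rewrite /sparse -sum1_card big_mkcond/=; congr (is_true (_ <= _)%N).
apply: eq_bigr => i _; case: (boolP (tnth theta i != 0)) => th_i.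
  by rewrite mem_set.
by rewrite memNset//=; exact/negP.
Qed.

Lemma sum_mixture {R : realFieldType} (p : R) (F : option bool * bool -> R) :
  \sum_(j : option bool * bool) three_weight p j.1 / 2 * F j =
  \sum_k three_weight p k / 2 * (F (k, true) + F (k, false)).
Proof.
transitivity (\sum_k \sum_(e : bool) three_weight p k / 2 * F (k, e)).
  by rewrite pair_bigA; apply: eq_bigr => -[].
by apply: eq_bigr => k _; rewrite big_bool /= mulrDr.
Qed.

Lemma sum_mixture_weight {R : realFieldType} (p : R) :
  \sum_(j : option bool * bool) three_weight p j.1 / 2 = 1.
Proof.
under eq_bigr do rewrite -[_ / 2]mulr1.
rewrite (sum_mixture p (fun=> 1)) -[RHS](sum_three_weight p).
by apply: eq_bigr => k _; field.
Qed.

(* The index [(k, e)] carries the outlier [B * k] and the sign [e]. *)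
Lemma mixture_law_G_class {R : realType} (a tau p B A : R)
    (wp : forall j : option bool * bool, 0 <= three_weight p j.1 / 2) :
  0 < p < 1 -> 0 < B -> 2 <= A -> B + 1 <= A ->
  (forall t, 2 <= t -> t < A -> p <= 2 * expR (- ((t / tau) `^ a))) ->
  G_class a tau (discrete_law
    (fun j => (B * three_value j.1 + sign_of j.2) / Num.sqrt (1 + p * B ^+ 2))
    wp (sum_mixture_weight p)).
Proof.
move=> p01 B_gt0 A2 BA p_tail.
have v_gt0 : 0 < 1 + p * B ^+ 2 by nra.
set sg := Num.sqrt (1 + p * B ^+ 2).
have sg2 : sg ^+ 2 = 1 + p * B ^+ 2 by rewrite sqr_sqrtr// ltW.
(* Dividing by [sg >= 1] only shrinks values, so bounds on [B * k + e] survive normalization. *)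
have sg_ge1 : 1 <= sg by rewrite -[leLHS]sqrtr1 ler_sqrt; nra.
have sg_gt0 : 0 < sg by lra.
apply: discrete_law_G_class.
- rewrite sum_mixture sum_option_bool /=; field; rewrite gt_eqF//.
- rewrite sum_mixture sum_option_bool /= !exprMn !exprVn sg2; field; rewrite gt_eqF//.
- move=> t t2.
  have sg_norm (u C : R) : `|u| <= C -> `|u / sg| <= C.
    move=> uC; rewrite normrM normfV (gtr0_norm sg_gt0) ler_pdivrMr//.
    have := normr_ge0 u; nra.
  (* Without an outlier the modulus is at most 1; only the outlier atoms, of total weight [p], can
     exceed [t]. *)
  have bound0 (e : R) : -1 <= e <= 1 -> (t < `|(B * 0 + e) / sg|) = false.
    move=> e1; apply/negbTE; rewrite -leNgt; apply: le_trans t2; apply: sg_norm.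
    by rewrite ler_norml; lra.
  have boundA (b e : R) : -1 <= b <= 1 -> -1 <= e <= 1 ->
      `|(B * b + e) / sg| <= A.
    by move=> b1 e1; apply: sg_norm; rewrite ler_norml; nra.
  rewrite sum_mixture sum_option_bool /= !bound0; [|lra|lra].
  (* From [A] on the tail is zero; below [A] it is at most [p], which [p_tail] controls. *)
  have [tA|At] := ltP t A; last first.
    have tailF (b e : R) : -1 <= b <= 1 -> -1 <= e <= 1 ->
        (t < `|(B * b + e) / sg|) = false.
      by move=> b1 e1; apply/negbTE; rewrite -leNgt; apply: le_trans At; exact: boundA.
    rewrite !tailF; [|lra..].
    by have := expR_ge0 (- ((t / tau) `^ a)); rewrite !mulr0n; lra.
  apply: le_trans (p_tail _ t2 tA).
  by do 4 case: (t < `|_|); rewrite ?mulr0n ?mulr1n; lra.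
Qed.

(** * Risk lower bounds for the two constructions *)

Section variance_risk.
Context {R : realType} (d : nat) (That : d.-tuple R -> R) (L : R -> R).

Definition variance_risk (P : probability R R) (sigma : R) (theta : d.-tuple R) :=
  model_expect P sigma theta (fun y => (L `|That y / sigma ^+ 2 - 1|)%:E).

Variables (delta l0 : R).
Hypotheses (l0_ge0 : 0 <= l0) (L_ge0 : forall u, 0 <= u -> 0 <= L u)
           (L_ge : forall u, delta <= u -> l0 <= L u).

(** Reduction from estimation to testing: the loss dominates [l0] times the indicator of a relative
    error of at least [delta]. *)
Lemma variance_risk_discrete_ge {I : finType} (w x : I -> R)
    (w_ge0 : forall i, 0 <= w i) (w_sum1 : \sum_i w i = 1) sigma theta :
  ((l0 * \sum_(f : d.-tuple I) (\prod_(i < d) w (tnth f i)) *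
      (delta <= `|That (obs theta sigma (map_tuple x f)) / sigma ^+ 2 - 1|)%R%:R)%:E
   <= variance_risk (discrete_law x w_ge0 w_sum1) sigma theta)%E.
Proof.
pose G (xi : d.-tuple R) : R :=
  l0 * (delta <= `|That (obs theta sigma xi) / sigma ^+ 2 - 1|)%R%:R.
rewrite mulr_sumr (eq_bigr (fun f : d.-tuple I =>
  (\prod_(i < d) w (tnth f i)) * G (map_tuple x f))); last first.
  by move=> f _; rewrite mulrCA.
apply: iid_expect_discrete_ge => t; rewrite /G; first by rewrite mulr_ge0.
by rewrite lee_fin; case: (boolP (delta <= _)) => h; rewrite ?mulr1 ?mulr0 ?L_ge ?L_ge0.
Qed.

Variables (a tau : R).

Lemma variance_risk_parametric (s : nat) (M : \bar R) : (0 < d)%N ->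
  delta <= (Num.sqrt d%:R)^-1 / 8 ->
  (forall P sigma theta, G_class a tau P -> 0 < sigma -> sparse s theta ->
     (variance_risk P sigma theta <= M)%E) ->
  ((l0 / 4)%:E <= M)%E.
Proof.
move=> d_gt0 delta_le M_ge.
set r := (Num.sqrt d%:R)^-1 in delta_le.
have d_gt0R : 0 < d%:R :> R by rewrite ltr0n.
have r_gt0 : 0 < r by rewrite invr_gt0 sqrtr_gt0.
have dr2 : d%:R * r ^+ 2 = 1.
  by rewrite exprVn sqr_sqrtr ?ltW// divff// gt_eqF.
have r_le1 : r <= 1.
  by rewrite invf_le1 ?sqrtr_gt0// -[leLHS]sqrtr1 ler_sqrt ?ler1n.
(* Small enough that [d * (4 * h ^+ 2) = 1/4], large enough that the relative gap [h / (1 + h)] is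
   at least [r / 8]. *)
pose h := r / 4.
have [q0 q1] : 0 < (2^-1 : R) < 1 /\ 0 < 2^-1 + h < 1 by rewrite /h; lra.
pose th0 : d.-tuple R := [tuple 0 | i < d].
have th0_sparse : sparse s th0.
  by rewrite sparseE big1// => i _; rewrite tnth_mktuple eqxx.
pose val f : d.-tuple R := map_tuple three_value f.
(* The scale undoes the normalization, so both hypotheses share the same observations and differ
   only in their weights. *)
have obsE q f : 0 < q -> obs th0 (Num.sqrt q)
    (map_tuple (fun o : option bool => three_value o / Num.sqrt q) f) = val f.
  move=> q_gt0; apply: eq_from_tnth => i; rewrite !tnth_mktuple !tnth_map add0r.
  by rewrite mulrC divfK// gt_eqF// sqrtr_gt0.
pose bad q f := delta <= `|That (val f) / q - 1|.
have risk_ge q : 2^-1 <= q < 1 ->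
    ((l0 * \sum_(f : d.-tuple _) (\prod_(i < d) three_weight q (tnth f i)) *
       (bad q f)%:R)%:E <= M)%E.
  move=> /andP[qge qlt].
  have q01 : 0 < q < 1 by lra.
  have q_gt0 : 0 < q by lra.
  have wq o := ltW (three_weight_gt0 q o q01).
  have sq_gt0 : 0 < Num.sqrt q by rewrite sqrtr_gt0.
  apply: le_trans (M_ge _ _ th0 (three_law_G_class a tau q qge wq) sq_gt0 th0_sparse).
  apply: le_trans (variance_risk_discrete_ge _ _ _ _ _ _).
  rewrite lee_fin le_eqVlt; apply/orP; left; apply/eqP; congr (_ * _).
  by apply: eq_bigr => f _; rewrite obsE// sqr_sqrtr// ltW.
have bad01 f : bad 2^-1 f || bad (2^-1 + h) f.
  apply: variance_separation; [lra|rewrite /h; lra|].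
  apply: le_trans delta_le _; rewrite ler_pdivlMr /h; last lra.
  nra.
have chi2 : (\sum_j three_weight (2^-1 + h) j ^+ 2 / three_weight 2^-1 j) ^+ d <= 4 / 3.
  have -> : \sum_j three_weight (2^-1 + h) j ^+ 2 / three_weight (2^-1) j = 1 + 4 * h ^+ 2.
    by rewrite sum_option_bool /=; field.
  (* The power is at most [expR (1/4)], and [expR (-1/4) >= 3/4] inverts to the bound [4/3]. *)
  apply: (@le_trans _ _ (expR (4 * h ^+ 2) ^+ d)).
    by rewrite lerXn2r ?expR_ge1Dx// nnegrE ?expR_ge0// addr_ge0// mulr_ge0// sqr_ge0.
  have h2 : d%:R * (4 * h ^+ 2) = 4^-1.
    by rewrite -[RHS]mul1r -[X in _ = X * _]dr2 /h; field.
  rewrite -expRM_natl h2 -[4^-1]opprK expRN.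
  have e_ge : 3 / 4 <= expR (- 4^-1 : R) by have := expR_ge1Dx (- 4^-1 : R); lra.
  rewrite -[4 / 3]invf_div lef_pV2// posrE ?expR_gt0//; lra.
have := two_point_test d _ _ _ _ (fun o => three_weight_gt0 _ o q0)
  (fun o => ltW (three_weight_gt0 _ o q1)) (sum_three_weight _) bad01.
move: (risk_ge 2^-1) (risk_ge (2^-1 + h)).
set S0 := \sum_f _; set S1 := \sum_f _ => risk0 risk1 S01.
(* The error probabilities sum to at least [1 - (4/3)/4 = 2/3], so one of them reaches [1/4]. *)
have [S0_ge|S0_lt] := leP 4^-1 S0.
  apply: le_trans (risk0 _); last lra.
  by rewrite lee_fin ler_wpM2l.
apply: le_trans (risk1 _); last by rewrite /h; lra.
rewrite lee_fin ler_wpM2l//; lra.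
Qed.


(** If [M < l0 / 4], the contaminated reading errs with probability below [1/4] on average over
    outlier patterns, and the sparse reading errs with probability below [1/4] for each sparse
    pattern. Since one reading always errs, the sparse patterns have mass below [1/3], against the
    [1/2] given by Markov. *)
Lemma variance_risk_sparse (s : nat) (p B A : R) (M : \bar R) :
  (0 < s)%N -> 0 < p < 1 -> d%:R * p / s%:R <= 2^-1 ->
  0 < B -> 2 <= A -> B + 1 <= A ->
  (forall t, 2 <= t -> t < A -> p <= 2 * expR (- ((t / tau) `^ a))) ->
  0 < l0 -> delta <= p * B ^+ 2 / (2 + p * B ^+ 2) ->
  (forall P sigma theta, G_class a tau P -> 0 < sigma -> sparse s theta ->
     (variance_risk P sigma theta <= M)%E) ->
  ((l0 / 4)%:E <= M)%E.
Proof.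
move=> s_gt0 p01 dps B_gt0 A2 BA p_tail l0_gt0 delta_le M_ge.
have v_gt0 : 0 < 1 + p * B ^+ 2 by nra.
rewrite leNgt; apply/negP => M_lt.
have wK (k : option bool) : 0 <= three_weight p k by rewrite ltW// three_weight_gt0.
have wJ (j : option bool * bool) : 0 <= three_weight p j.1 / 2.
  by rewrite divr_ge0.
pose Ktup := d.-tuple (option bool); pose Etup := d.-tuple bool.
pose th0 : d.-tuple R := [tuple 0 | i < d].
have th0_sparse : sparse s th0.
  by rewrite sparseE big1// => i _; rewrite tnth_mktuple eqxx.
pose th (k : Ktup) : d.-tuple R := map_tuple (fun o => B * three_value o) k.
pose few (k : Ktup) := (\sum_(i < d) (tnth k i != None) <= s)%N.
have th_sparse k : few k -> sparse s (th k).
  rewrite sparseE; apply: leq_trans; apply: leq_sum => i _.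
  by rewrite tnth_map; case: (tnth k i) => [b|] /=; rewrite ?leq_b1// mulr0 eqxx.
pose y (k : Ktup) (e : Etup) := obs (th k) 1 (map_tuple sign_of e).
pose sg := Num.sqrt (1 + p * B ^+ 2).
have sg_gt0 : 0 < sg by rewrite sqrtr_gt0.
have sg2 : sg ^+ 2 = 1 + p * B ^+ 2 by rewrite sqr_sqrtr// ltW.
pose bad v k e := delta <= `|That (y k e) / v - 1|.
have bad01 k e : bad 1 k e || bad (1 + p * B ^+ 2) k e.
  apply: variance_separation => //; apply: le_trans delta_le _.
  have -> : 1 + p * B ^+ 2 - 1 = p * B ^+ 2 by ring.
  by have -> : 1 + p * B ^+ 2 + 1 = 2 + p * B ^+ 2 by ring.
pose WK (k : Ktup) := \prod_(i < d) three_weight p (tnth k i).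
have WK_ge0 k : 0 <= WK k by apply: prodr_ge0.
have WK_sum : \sum_k WK k = 1 by apply: sum_prod_tuple1; exact: sum_three_weight.
pose WE : R := \prod_(i < d) 2^-1.
have WE_ge0 : 0 <= WE by apply: prodr_ge0.
have WE_sum : \sum_(e : Etup) WE = 1.
  exact: (sum_prod_tuple1 d (fun=> 2^-1) sum_fair_coin).
pose r0 k := \sum_(e : Etup) WE * (bad (1 + p * B ^+ 2) k e)%:R.
pose r1 k := \sum_(e : Etup) WE * (bad 1 k e)%:R.
have risk0 : l0 * \sum_k WK k * r0 k < l0 / 4.
  rewrite -lte_fin; apply: le_lt_trans M_lt.
  apply: le_trans (M_ge _ sg th0
    (mixture_law_G_class a tau p B A wJ p01 B_gt0 A2 BA p_tail) sg_gt0 th0_sparse).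
  apply: le_trans (variance_risk_discrete_ge _ _ _ _ _ _).
  rewrite lee_fin le_eqVlt; apply/orP; left; apply/eqP; congr (_ * _).
  (* The contaminated law is a mixture: first the outlier pattern [k], then independent fair signs
     [e]. *)
  rewrite tuple_sum_pair; apply: eq_bigr => k _; rewrite mulr_sumr.
  apply: eq_bigr => e _; rewrite mulrA -big_split/= sg2; congr (_ * _).
    by apply: eq_bigr => i _; rewrite tnth_mktuple.
  (* Both readings produce the same data [y k e]. *)
  congr ((_ <= `|That _ / _ - 1|)%R%:R).
  apply: eq_from_tnth => i; rewrite !tnth_mktuple !tnth_map ?tnth_ord_tuple/=.
  by rewrite add0r mul1r [RHS]mulrC divfK// gt_eqF.
have risk1 k : few k -> l0 * r1 k < l0 / 4.
  move=> /th_sparse thk; rewrite -lte_fin; apply: le_lt_trans M_lt.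
  apply: le_trans (M_ge _ 1 (th k) (rademacher_G_class a tau) ltr01 thk).
  apply: le_trans (variance_risk_discrete_ge _ _ _ _ _ _).
  by rewrite expr1n.
have few_ge : 2^-1 <= \sum_(k | few k) WK k.
  apply: le_trans (count_tail d s _ (fun o => o != None) wK (sum_three_weight p) s_gt0).
  rewrite (_ : \sum_(j | _) _ = p); first lra.
  by rewrite big_mkcond sum_option_bool /=; field.
have r01 k : 1 <= r0 k + r1 k.
  rewrite -WE_sum -big_split/=; apply: ler_sum => e _.
  move: (bad01 k e); case: (bad 1 k e); case: (bad _ k e) => //= _;
    rewrite ?mulr1 ?mulr0; lra.
have r0_ge0 k : 0 <= r0 k by apply: sumr_ge0 => e _; rewrite mulr_ge0.
have few_sum : \sum_(k | few k) WK k <= \sum_k WK k * r0 k + \sum_(k | few k) WK k * 4^-1.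
  rewrite [leLHS]big_mkcond [X in _ + X]big_mkcond -big_split/=.
  apply: ler_sum => k _; have W0 := WK_ge0 k; have r00 := r0_ge0 k.
  (* On a sparse pattern [r1 k < 1/4], hence [r0 k > 3/4]. *)
  case: ifPn => [/risk1 r1_lt|_]; last by rewrite addr0 mulr_ge0.
  have {}r1_lt : r1 k < 4^-1 by rewrite -(ltr_pM2l l0_gt0).
  rewrite -mulrDr ler_peMr//; have := r01 k; lra.
have {}risk0 : \sum_k WK k * r0 k < 4^-1 by rewrite -(ltr_pM2l l0_gt0).
move: few_sum; rewrite -mulr_suml; lra.
Qed.

End variance_risk.

(** * Calibration of the constants *)

Lemma sparse_rate_le {R : realType} (k x : R) : 0 < k -> 0 < x <= 1 ->
  x * (1 - ln x) `^ k <= expR 1 * k `^ k.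
Proof.
move=> k_gt0 /andP[x_gt0 x_le1].
have y_ge0 : 0 <= 1 - ln x by rewrite subr_ge0 (le_trans (ln_le0 x_le1)).
have z_ge0 : 0 <= (1 - ln x) / k by rewrite divr_ge0// ltW.
have -> : 1 - ln x = k * ((1 - ln x) / k) by rewrite mulrCA divff ?mulr1// gt_eqF.
rewrite powRM ?(ltW k_gt0)//.
(* With [z = (1 - ln x) / k], the bound [z <= expR z] gives [z ^ k <= expR (k * z) = e / x]. *)
have le_exp : ((1 - ln x) / k) `^ k <= expR 1 / x.
  have -> : expR 1 / x = expR ((1 - ln x) / k) `^ k.
    by rewrite -expRM divfK ?gt_eqF// expRB lnK.
  rewrite ge0_ler_powR ?nnegrE ?expR_ge0 ?(ltW k_gt0)//.
  by apply: le_trans (expR_ge1Dx _); rewrite lerDr.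
have kk : 0 <= k `^ k := powR_ge0 _ _.
rewrite mulrCA mulrC ler_wpM2r//.
by rewrite [leLHS]mulrC -ler_pdivlMr.
Qed.

Theorem theorem5 (R : realType) (tau a : R) (l : R -> R) :
  0 < tau -> 0 < a -> loss_class l ->
  exists c c' : R, 0 < c /\ 0 < c' /\
    forall (s d : nat), (1 <= s)%N -> (s <= d)%N ->
    forall That : d.-tuple R -> R, measurable_fun setT That ->
      (c'%:E <= ereal_sup
         [set v | exists (P : probability R R) (sigma : R) (theta : d.-tuple R),
            [/\ G_class a tau P, (0 < sigma)%R, sparse s theta &
             v = model_expect P sigma theta
                   (fun y => (l (c * (phi_exp a s d)^-1
                                  * `|That y / sigma ^+ 2 - 1|))%:E)]])%E.
Proof.
move=> tau_gt0 a_gt0 [l_mono l0 l_ge0 [x0 [x0_ge0 lx0_neq0]]].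
have x0_gt0 : 0 < x0.
  by rewrite lt0r x0_ge0 andbT; apply: contraNneq lx0_neq0 => ->; rewrite l0.
have lx0_gt0 : 0 < l x0 by rewrite lt0r lx0_neq0 l_ge0.
pose k := 2 / a; have k_gt0 : 0 < k by rewrite divr_gt0.
pose K := expR 1 * k `^ k.
have K_ge0 : 0 <= K by rewrite mulr_ge0 ?expR_ge0 ?powR_ge0.
have den_gt0 : 0 < 16 + K * tau ^+ 2.
  by rewrite ltr_pwDl// mulr_ge0// sqr_ge0.
(* The entry [1/8] serves the parametric term. The other serves the sparse term, where [phi <= K]
   bounds the denominator [16 + phi * tau ^+ 2]. *)
pose eta := Num.min (1 / 8) (tau ^+ 2 / (16 + K * tau ^+ 2)).
have eta_gt0 : 0 < eta by rewrite lt_min !divr_gt0// exprn_gt0.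
have eta_le8 : eta <= 1 / 8 by rewrite ge_min lexx.
have eta_leK : eta <= tau ^+ 2 / (16 + K * tau ^+ 2) by rewrite ge_min lexx orbT.
(* This scale sends a relative error [phi * eta] to [x0], where the loss is positive. *)
exists (x0 / eta), (l x0 / 4); split; first by rewrite divr_gt0.
split; first by rewrite divr_gt0.
move=> s d s_gt0 s_le_d That _.
have d_gt0 : (0 < d)%N by apply: leq_trans s_le_d.
have s_gt0R : 0 < s%:R :> R by rewrite ltr0n.
have d_gt0R : 0 < d%:R :> R by rewrite ltr0n.
set phi := phi_exp a s d; set M := ereal_sup _.
pose x : R := s%:R / d%:R.
have x_gt0 : 0 < x by rewrite divr_gt0.
have x_le1 : x <= 1 by rewrite ler_pdivrMr// mul1r ler_nat.
have lnE : ln (expR 1 * d%:R / s%:R) = 1 - ln x.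
  by rewrite -mulrA -invf_div lnM ?posrE ?expR_gt0 ?invr_gt0// expRK lnV.
pose Y := 1 - ln x.
have Y_ge1 : 1 <= Y by rewrite lerDl oppr_ge0 ln_le0.
have phiE : phi = Num.max (Num.sqrt d%:R)^-1 (x * Y `^ k) by rewrite /phi /phi_exp lnE.
have phi_gt0 : 0 < phi by rewrite phiE lt_max invr_gt0 sqrtr_gt0 d_gt0R.
pose L u := l (x0 / eta * phi^-1 * u).
pose delta := phi * eta.
have scale_gt0 : 0 < x0 / eta * phi^-1 by rewrite !mulr_gt0// invr_gt0.
have L_ge0 u : 0 <= u -> 0 <= L u by move=> u0; rewrite l_ge0// mulr_ge0// ltW.
have L_ge u : delta <= u -> l x0 <= L u.
  move=> du; have x0_le : x0 <= x0 / eta * phi^-1 * u.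
    rewrite [leLHS](_ : _ = x0 / eta * phi^-1 * delta); last first.
      by rewrite /delta; field; rewrite !gt_eqF.
    by rewrite ler_pM2l.
  by rewrite l_mono// in_itv/= andbT// (le_trans x0_ge0).
have M_ge P sigma theta : G_class a tau P -> 0 < sigma -> sparse s theta ->
    (variance_risk d That L P sigma theta <= M)%E.
  by move=> ? ? ?; apply: ereal_sup_ubound; exists P, sigma, theta.
(* Only the construction matching the larger term of the rate is used. *)
have [sparse_le|/ltW parametric_le] := leP (x * Y `^ k) (Num.sqrt d%:R)^-1.
  apply: (variance_risk_parametric d That L delta _ (ltW lx0_gt0) L_ge0 L_ge a tau s
    M d_gt0 _ M_ge).
  rewrite /delta phiE max_l// ler_wpM2l ?invr_ge0 ?sqrtr_ge0//; lra.
have phi_sparse : phi = x * Y `^ k by rewrite phiE max_r.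
(* At [t = tau * Y ^ (1/a)] the exponential tail equals [expR (- Y) = x / e], comparable to the
   outlier probability; the tail condition starts at 2. *)
pose A := Num.max 2 (tau * Y `^ a^-1).
have A_ge2 : 2 <= A by rewrite le_max lexx.
have A_ge : tau * Y `^ a^-1 <= A by rewrite le_max lexx orbT.
have Y1_ge0 : 0 <= Y `^ a^-1 by rewrite powR_ge0.
(* With [p = x / 2] the mean number of outliers is [s / 2]; [B = A / 2] leaves room for the sign
   because [A >= 2]. *)
apply: (variance_risk_sparse d That L delta _ (ltW lx0_gt0) L_ge0 L_ge a tau s
  (x / 2) (A / 2) A M s_gt0 _ _ _ A_ge2 _ _ lx0_gt0 _ M_ge).
- lra.
- by rewrite le_eqVlt; apply/orP; left; apply/eqP; rewrite /x; field; rewrite !gt_eqF.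
- lra.
- lra.
- move=> t t2 tA.
  have {}tA : t < tau * Y `^ a^-1 by move: tA; rewrite lt_max ltNge t2.
  have e_half : 2^-1 <= expR (- 2^-1 : R) by have := expR_ge1Dx (- 2^-1 : R); lra.
  have e_quarter : 4^-1 <= expR (- 1 : R).
    rewrite (_ : - 1 = - 2^-1 + - 2^-1 :> R); last lra.
    by rewrite expRD; nra.
  (* Twice [x / 4] is exactly [p]; the constant comes from [1 / e >= 1/4]. *)
  have tail_ge : x / 4 <= expR (- ((t / tau) `^ a)).
    apply: (@le_trans _ _ (expR (- Y))).
      by rewrite /Y opprB addrC expRD lnK// mulrC ler_pM2r.
    rewrite ler_expR lerN2 -[leRHS]powRr1 ?(le_trans _ Y_ge1)//.
    rewrite -[in leRHS](@mulVf _ a) ?gt_eqF// powRrM.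
    rewrite ge0_ler_powR ?nnegrE ?(ltW a_gt0) ?divr_ge0 ?(ltW tau_gt0)//.
      by rewrite (le_trans _ t2).
    by rewrite ler_pdivrMr// mulrC ltW.
  lra.
- set Z := x / 2 * (A / 2) ^+ 2.
  have Z_ge : phi * tau ^+ 2 / 8 <= Z.
    have Yk : Y `^ k = (Y `^ a^-1) ^+ 2.
      by rewrite -powR_mulrn// -powRrM mulrC.
    have : (tau * Y `^ a^-1) ^+ 2 <= A ^+ 2.
      by rewrite lerXn2r// nnegrE ?mulr_ge0// ?ltW//; lra.
    rewrite phi_sparse Yk /Z; nra.
  have phi_le : phi <= K.
    by rewrite phi_sparse; apply: sparse_rate_le => //; rewrite x_gt0.
  have tau2 : 0 < tau ^+ 2 by rewrite exprn_gt0.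
  have X_gt0 : 0 < phi * tau ^+ 2 by rewrite mulr_gt0.
  have den_phi_gt0 : 0 < 16 + phi * tau ^+ 2 by lra.
  (* The middle term is [z / (2 + z)] at [z = phi * tau ^+ 2 / 8 <= Z], and this map is
     increasing. *)
  apply: (@le_trans _ _ (phi * tau ^+ 2 / (16 + phi * tau ^+ 2))).
    rewrite /delta -mulrA ler_pM2l//; apply: le_trans eta_leK _.
    by rewrite ler_pM2l// lef_pV2 ?posrE// lerD2l ler_pM2r.
  rewrite ler_pdivrMr; last lra.
  rewrite mulrAC ler_pdivlMr; last lra.
  lra.
Qed.
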